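(* Let $\mathcal{X}\subset\mathbb{R}^n$ be open and let $\Phi\in C^0(\mathcal{X},\mathbb{R}^n)$ be a map which has at least one component $\Phi_i\in C^0(\mathcal{X},\mathbb{R})$, $i\in\{1,\ldots,n\}$, which is a topological Morse function with a topologically critical point. Then, under Assumptions 1 and 2, the map $\Phi$ cannot be embedded in the augmented neural ODE architecture $\mathrm{NODE}_{(3)}$; i.e. for no $m>n$ is there a vector field $f:\mathbb{R}^m\times[0,T]\to\mathbb{R}^m$ satisfying Assumptions 1 and 2 such that for all $x\in\mathcal{X}$ one has $h_{(x,0)^\top}(T)\in\mathbb{R}^n\times\{0\}^{m-n}$ and $\Phi(x)=[h_{(x,0)^\top}(T)]_{1,\ldots,n}$.
   Context: Fix $T>0$. An augmented neural ODE in dimension $m>n$ is the initial value problem $\frac{dh}{dt}=f(h(t),t)$, $h(0)=(x,0)^\top\in\mathcal{X}\times\{0\}^{m-n}\subset\mathbb{R}^m$, with $f:\mathbb{R}^m\times[0,T]\to\mathbb{R}^m$ continuous; its solution is denoted $h_{(x,0)^\top}$. It is required that $h_{(x,0)^\top}(T)\in\mathbb{R}^n\times\{0\}^{m-n}$, and the architecture is the map $\mathrm{NODE}_{(3)}:\mathcal{X}\to\mathbb{R}^n$, $\mathrm{NODE}_{(3)}(x):=[h_{(x,0)^\top}(T)]_{1,\ldots,n}$ (the first $n$ components). Assumption 1: the vector field $f$ is continuous and the solution of the initial value problem exists for all $t\in[0,T]$. Assumption 2: the vector field $f$ is continuous and the solution of the initial value problem is unique for all $t\in\mathcal{I}$,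 where $\mathcal{I}$ is the maximal time interval of existence; uniqueness is understood in the sense that solution curves do not cross (two solutions of the ODE that agree at some time agree at all times at which both exist). Let $\Psi\in C^0(\mathcal{X},\mathbb{R})$ with $\mathcal{X}\subset\mathbb{R}^n$ open. A point $q\in\mathcal{X}$ is topologically ordinary if there exist a neighborhood $\mathcal{V}$ of $0\in\mathbb{R}^n$ and a homeomorphism $\eta:\mathcal{V}\to\eta(\mathcal{V})$ (onto its image in $\mathcal{X}$) with $\eta(0)=q$ and $\Psi(\eta(v_1,\ldots,v_n))=\Psi(q)+v_n$ for all $(v_1,\ldots,v_n)\in\mathcal{V}$. A point $p\in\mathcal{X}$ that is not topologically ordinary is topologically critical. A topologically critical point $p$ has index $k$ if there exist a neighborhood $\mathcal{U}$ of $0\in\mathbb{R}^n$ and a homeomorphism $\mu:\mathcal{U}\to\mu(\mathcal{U})$ (onto its image in $\mathcal{X}$) with $\mu(0)=p$ and $\Psi(\mu(u_1,\ldots,u_n))=\Psi(p)-\sum_{j=1}^k u_j^2+\sum_{j=k+1}^n u_j^2$ for all $(u_1,\ldots,u_n)\in\mathcal{U}$. $\Psi$ is a topological Morse function if every topologically critical point of $\Psi$ has some index in $\{0,1,\ldots,n\}$. *)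

(* Defs.v *)
From HB Require Import structures.
From mathcomp Require Import all_boot all_order all_algebra.
From mathcomp Require Import all_classical all_reals all_analysis.

Set Implicit Arguments.
Unset Strict Implicit.
Unset Printing Implicit Defensive.

Import Order.TTheory GRing.Theory Num.Theory numFieldNormedType.Exports.
Local Open Scope classical_set_scope.
Local Open Scope ring_scope.

(* Vectors of R^n are row vectors 'rV[R]_n.  R^m with m > n is written
   'rV[R]_(n + d) with d > 0, so that (x, 0) is row_mx x 0, and the first n and
   the last m - n components of y are lsubmx y and rsubmx y. *)

Section TopologicalMorse.
Context {R : realType} {n : nat}.
Implicit Types (X : set 'rV[R]_n) (Psi : 'rV[R]_n -> R) (p q : 'rV[R]_n).

(* No openness of the image is required. *)
Definition homeomorphism_onto_image (V : set 'rV[R]_n)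
    (e : 'rV[R]_n -> 'rV[R]_n) : Prop :=
  {within V, continuous e} /\
  exists g : 'rV[R]_n -> 'rV[R]_n,
    (forall v, V v -> g (e v) = v) /\ {within e @` V, continuous g}.

(* The index j with j.+1 = n is that of the last coordinate. *)
Definition topologically_ordinary X Psi q : Prop :=
  X q /\
  exists (V : set 'rV[R]_n) (eta : 'rV[R]_n -> 'rV[R]_n),
    [/\ nbhs (0 : 'rV[R]_n) V, homeomorphism_onto_image V eta, eta @` V `<=` X, eta 0 = q &
        forall v, V v -> forall j : 'I_n, j.+1 = n ->
          Psi (eta v) = Psi q + v 0 j].

Definition topologically_critical X Psi p : Prop :=
  X p /\ ~ topologically_ordinary X Psi p.

Definition has_index X Psi p (k : nat) : Prop :=
  exists (U : set 'rV[R]_n) (mu : 'rV[R]_n -> 'rV[R]_n),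
    [/\ nbhs (0 : 'rV[R]_n) U, homeomorphism_onto_image U mu, mu @` U `<=` X, mu 0 = p &
        forall u, U u ->
          Psi (mu u) = Psi p - \sum_(j < n | (j < k)%N) u 0 j ^+ 2
                             + \sum_(j < n | (k <= j)%N) u 0 j ^+ 2].

Definition topological_Morse X Psi : Prop :=
  {within X, continuous Psi} /\
  forall p, topologically_critical X Psi p ->
    exists2 k, (k <= n)%N & has_index X Psi p k.

End TopologicalMorse.

Section ODE.
Context {R : realType} {m : nat}.
Variables (T : R) (f : 'rV[R]_m -> R -> 'rV[R]_m).
Implicit Types (J : set R) (h : R -> 'rV[R]_m).

(* f is only relevant on R^m x [0, T]; its values at other times are junk. *)
Definition continuous_field : Prop :=
  {within [set z : 'rV[R]_m * R | 0 <= z.2 <= T],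
    continuous (fun z => f z.1 z.2)}.

(* h solves h' = f(h, t) on the time set J; at an endpoint of J belonging to J,
   the derivative is one-sided.  The values of h outside J are irrelevant. *)
Definition ode_solution J h : Prop :=
  forall t, J t ->
    (fun s => (s - t)^-1 *: (h s - h t)) @ within J t^' --> f (h t) t.

Definition ivp_solution (y0 : 'rV[R]_m) h : Prop :=
  h 0 = y0 /\ ode_solution [set t | 0 <= t <= T] h.

Definition assumption1 (Y0 : set 'rV[R]_m) : Prop :=
  continuous_field /\ forall y0, Y0 y0 -> exists h, ivp_solution y0 h.

(* Solution curves do not cross: this concerns all solutions of the ODE, on
   arbitrary subintervals of [0, T] and with arbitrary initial values. *)
Definition assumption2 : Prop :=
  continuous_field /\
  forall (J1 J2 : set R) (h1 h2 : R -> 'rV[R]_m),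
    is_interval J1 -> J1 `<=` [set t | 0 <= t <= T] ->
    is_interval J2 -> J2 `<=` [set t | 0 <= t <= T] ->
    ode_solution J1 h1 -> ode_solution J2 h2 ->
    (exists2 t, (J1 `&` J2) t & h1 t = h2 t) ->
    forall t, (J1 `&` J2) t -> h1 t = h2 t.

End ODE.

(* By assumptions 1 and 2, for each x in X the h quantified below exists and is
   unique on [0, T]. *)
Definition embeddable_in_NODE3 {R : realType} {n : nat} (T : R)
    (X : set 'rV[R]_n) (Phi : 'rV[R]_n -> 'rV[R]_n) : Prop :=
  exists (d : nat) (f : 'rV[R]_(n + d) -> R -> 'rV[R]_(n + d)),
    [/\ (0 < d)%N,
        assumption1 T f [set row_mx x 0 | x in X],
        assumption2 T f &
        forall x, X x -> forall h, ivp_solution T f (row_mx x 0) h ->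
          rsubmx (h T) = 0 /\ Phi x = lsubmx (h T)].

(* Main.v *)
Require Import Defs.
From HB Require Import structures.
From mathcomp Require Import all_boot all_order all_algebra.
From mathcomp Require Import all_classical all_reals all_analysis.
From mathcomp Require Import perm ring lra.
Import Order.TTheory GRing.Theory Num.Theory numFieldNormedType.Exports.

(** Solution curves of the ODE do not cross, so the map sending x to the
    endpoint h(T) of the curve issued from (x, 0) is injective; all those
    endpoints lie in R^n x {0}, so Phi itself is injective on X
    ([node_endpoint_injective]). A continuous injective map between open
    subsets of R^n is open and has a continuous inverse, so Phi is a chart
    around every point of X; in this chart the component Phi_i is a coordinate
    function, and permuting coordinates makes it the last one. Hence every
    point of X is topologically ordinary for Phi_i
    ([injective_topologically_ordinary]), and there is no room for a critical
    point.

    What remains is invariance of domain. Let B be the closed unit ball of the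
    sup norm, f : B -> R^n continuous and injective, K = f(B), and G a
    continuous extension to R^n of the inverse of f. The map G o f is the
    identity of B, and every continuous map B -> R^n within distance 1 of the
    identity has a zero ([near_identity_zero]); so no continuous function
    uniformly close to G on K can avoid the value 0. If f(0) were not interior to K, such a function
    could be built. Choose c outside K very close to f(0), and push K radially
    out of a small ball centred at c. After the push, what lies off the sphere
    bounding this ball is a part of K where G is bounded away from 0, while on
    the sphere G is small, so G can be perturbed there at little cost. A
    Lipschitz approximation P of G ([lipschitz_approx]) sends the sphere, which
    has dimension n - 1, to a set without interior
    ([sphere_image_misses]); subtracting from P a small vector outside
    P(sphere) removes the last zeros ([unit_ball_image_nbhs]).

    The zero theorem [near_identity_zero] is a form of the Poincare-Miranda
    theorem. It is deduced from a combinatorial lemma on a cubical grid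
    ([cubical_sperner]): n boolean labellings, the i-th one being 0 on the face
    x_i = 0 and 1 on the opposite face, all change value inside a common unit
    cube. Indeed the cup product dg_1 u ... u dg_n of their coboundaries mod 2
    is the coboundary of g_1 dg_2 u ... u dg_n, and Stokes' formula reduces its
    sum over the whole grid to the same sum on the face x_1 = max, hence
    inductively to 1; so the product is nonzero on some unit cube. *)
Set Implicit Arguments.
Unset Strict Implicit.
Unset Printing Implicit Defensive.

Local Open Scope ring_scope.

(** * Mod 2 cup products on cubical grids *)
Lemma addrr_F2 (x : 'F_2) : x + x = 0.
Proof. by case: x => -[|[|]] // ?; apply: val_inj. Qed.

Section CubicalCup.
Variables (V : zmodType) (I : finType) (e : I -> V).
Implicit Types (J : {set I}) (q : V) (gs : seq (V -> 'F_2)).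

(** The cup product dg_1 u ... u dg_k of the coboundaries of the functions in
    [gs], evaluated on the cube with corner [q] spanned by the directions in
    [J]: a sum over the monotone edge paths from [q] to the opposite corner,
    where [g_i] is differentiated along the i-th edge. Coefficients mod 2 make
    the signatures of the paths disappear. *)
Fixpoint cup_diff gs J q : 'F_2 :=
  if gs is g :: gs' then
    \sum_(j in J) (g (q + e j) + g q) * cup_diff gs' (J :\ j) (q + e j)
  else 1.

Lemma sum_pairs_swap J (F : I -> I -> 'F_2) :
  \sum_(j in J) \sum_(k in J :\ j) F j k =
  \sum_(j in J) \sum_(k in J :\ j) F k j.
Proof.
rewrite (exchange_big_dep (fun k => k \in J)) /=; last first.
  by move=> j k _ /setD1P[].
apply: eq_bigr => j jJ; apply: eq_bigl => k.
by rewrite !inE jJ eq_sym andbT andbC.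
Qed.

Lemma sum_pairs_sym0 J (F : I -> I -> 'F_2) : (forall j k, F j k = F k j) ->
  \sum_(j in J) \sum_(k in J :\ j) F j k = 0.
Proof.
move=> Fsym; pose lt (j k : I) := (enum_rank j < enum_rank k)%N.
pose H j k := if lt j k then F j k else 0.
have -> : \sum_(j in J) \sum_(k in J :\ j) F j k =
    \sum_(j in J) \sum_(k in J :\ j) H j k +
    \sum_(j in J) \sum_(k in J :\ j) H k j.
  rewrite -big_split; apply: eq_bigr => j _ /=.
  rewrite -big_split; apply: eq_bigr => k /setD1P[kj _] /=.
  rewrite /H /lt; case: (ltngtP (enum_rank j) (enum_rank k)) => [||jk].
  - by rewrite addr0.
  - by rewrite add0r Fsym.
  - by move/val_inj/enum_rank_inj: jk kj => ->; rewrite eqxx.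
by rewrite [X in _ + X]sum_pairs_swap addrr_F2.
Qed.

Lemma setD1C J j k : (J :\ j) :\ k = (J :\ k) :\ j.
Proof. by rewrite !finset.setDDl finset.setUC. Qed.

(** A product of coboundaries is a cocycle: the two sides are its sums over the
    far and the near facets of a cube. Expanding the first factor and applying
    the induction hypothesis to the remaining ones leaves sums over ordered
    pairs of directions whose terms are symmetric, and these vanish mod 2. *)
Lemma cup_closed gs J q : #|J| = (size gs).+1 ->
  \sum_(j in J) cup_diff gs (J :\ j) (q + e j) = \sum_(j in J) cup_diff gs (J :\ j) q.
Proof.
elim: gs J q => [//|g gs IH] J q /= sJ.
have sJ1 j : j \in J -> #|J :\ j| = (size gs).+1.
  by move=> jJ; move: (cardsD1 j J); rewrite jJ sJ /= => -[].
pose c j k q := cup_diff gs ((J :\ j) :\ k) q.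
have csym j k x : c j k x = c k j x by rewrite /c setD1C.
transitivity (\sum_(j in J) \sum_(k in J :\ j)
    (g (q + e j + e k) * c j k (q + e j + e k) +
     g (q + e j) * c j k (q + e j + e k))).
  by apply: eq_bigr => j _; apply: eq_bigr => k _; rewrite -mulrDl.
under [LHS]eq_bigr do rewrite big_split /=.
rewrite big_split /= sum_pairs_sym0 ?add0r; last first.
  by move=> j k; rewrite csym addrAC.
transitivity (\sum_(j in J) \sum_(k in J :\ j) g (q + e j) * c j k (q + e j)).
  by apply: eq_bigr => j jJ; rewrite -!mulr_sumr IH // sJ1.
symmetry.
transitivity (\sum_(j in J) \sum_(k in J :\ j)
    (g (q + e k) * c j k (q + e k) + g q * c j k (q + e k))).
  by apply: eq_bigr => j _; apply: eq_bigr => k _; rewrite -mulrDl.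
under [LHS]eq_bigr do rewrite big_split /=.
rewrite big_split /= -[RHS]addr0; congr (_ + _).
  rewrite sum_pairs_swap; apply: eq_bigr => j _; apply: eq_bigr => k _.
  by rewrite csym.
transitivity (\sum_(j in J) \sum_(k in J :\ j) g q * c j k q).
  by apply: eq_bigr => j jJ; rewrite -!mulr_sumr IH // sJ1.
by apply: sum_pairs_sym0 => j k; rewrite csym.
Qed.

(** The Leibniz rule: dg u w is the coboundary of g w, because w is closed. *)
Lemma cup_exact g gs J q : #|J| = (size gs).+1 ->
  cup_diff (g :: gs) J q =
  \sum_(j in J) (g (q + e j) * cup_diff gs (J :\ j) (q + e j) +
                 g q * cup_diff gs (J :\ j) q).
Proof.
move=> sJ /=; under eq_bigr do rewrite mulrDl.
by rewrite !big_split /= -!mulr_sumr cup_closed.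
Qed.

(** Each path contributes the product of the increments of the functions along
    its edges. The relation [P J q] describes the vertices [q] at which a path
    may arrive with the directions [J] still to be followed; a function [g]
    that is constant on all of these has no increment on any path. Letting [P]
    depend on [J] records that each direction is followed only once. *)
Lemma cup_eq0 (P : {set I} -> V -> Prop) g gs J q :
  (forall J k q, k \in J -> P J q -> P (J :\ k) (q + e k)) ->
  (forall J1 J2 x y, P J1 x -> P J2 y -> g x = g y) ->
  (exists gs1 gs2, gs = gs1 ++ g :: gs2) -> P J q -> cup_diff gs J q = 0.
Proof.
move=> Pstep Pg [gs1 [gs2 ->]]; elim: gs1 J q => [|g1 gs1 IH] J q Pq /=.
  apply: big1 => j jJ.
  by rewrite (Pg _ _ _ _ (Pstep _ _ _ jJ Pq) Pq) addrr_F2 mul0r.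
by apply: big1 => j jJ; rewrite IH ?mulr0 //; apply: Pstep.
Qed.

End CubicalCup.

(** The grid is {0, ..., M + 1}^I, seen as a power of Z/(M + 2): unit steps are
    then translations of a group, which makes sums over the grid easy to
    reindex. Cubes wrapping around the grid are excluded by [face]. *)
Section Grid.
Variables (I : finType) (M : nat).
Notation V := {ffun I -> 'I_M.+2}.
Implicit Types (J : {set I}) (q x y : V).

Definition unit_step (j : I) : V := [ffun k => if k == j then 1 else 0].

(** The corners of the unit cubes that tile the face of the grid spanned by
    [J], on which all coordinates outside [J] are maximal. *)
Definition face J q := [forall k, (k \in J) == (q k != ord_max)].

(** Summing differences in the direction [j] leaves the two ends of the grid.
    The second sum ranges over the facet where coordinate [j] is zero: the
    update of [q] at [j] only serves to free this coordinate from the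
    requirement, imposed by [face], of being maximal. *)
Lemma face_telescope J j (F : V -> 'F_2) : j \in J ->
  \sum_(q : V | face J q) (F (q + unit_step j) + F q) =
  \sum_(q : V | face (J :\ j) q) F q +
  \sum_(q : V | face (J :\ j) [ffun k => if k == j then ord_max else q k]
            && (q j == 0)) F q.
Proof.
move=> jJ.
pose b q := face (J :\ j) [ffun k => if k == j then ord_max else q k].
have bE q : b q = [forall k, (k != j) ==> ((k \in J) == (q k != ord_max))].
  apply: eq_forallb => k; rewrite !ffunE !inE; case: (eqVneq k j) => //= _; rewrite ?eqxx //.
have faceJ q : face J q = b q && (q j != ord_max).
  rewrite bE; apply/forallP/andP => [h|[/forallP h qj] k].
    split; last by rewrite -(eqP (h j)).
    by apply/forallP => k; apply/implyP.
  by case: (eqVneq k j) (h k) => // -> _; rewrite jJ qj.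
have faceJj q : face (J :\ j) q = b q && (q j == ord_max).
  rewrite bE; apply/forallP/andP => [h|[/forallP h qj] k].
    split; last by have := h j; rewrite !inE eqxx /= eq_sym eqbF_neg negbK.
    by apply/forallP => k; apply/implyP => kj; have := h k; rewrite !inE kj.
  by have := h k; rewrite !inE; case: (eqVneq k j) => //= -> _; rewrite qj.
rewrite big_split /=.
have -> : \sum_(q : V | face J q) F (q + unit_step j) =
    \sum_(q : V | b q && (q j != 0)) F q.
  rewrite [RHS](reindex_inj (addIr (unit_step j))); apply: eq_bigl => q.
  rewrite faceJ !bE; congr (_ && _).
    apply: eq_forallb => k; rewrite !ffunE.
    by case: eqP => //= _; rewrite addr0.
  rewrite !ffunE eqxx; congr (~~ _); rewrite -(inj_eq (addIr 1)).
  by congr (_ == _); apply: val_inj; rewrite /= (modn_small (_ : 1 < M.+2)%N) // addn1 modnn.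
under [X in _ + X = _]eq_bigl => q do rewrite faceJ.
under [X in _ = X + _]eq_bigl => q do rewrite faceJj.
have split_at a : \sum_(q : V | b q && (q j != a)) F q =
    \sum_(q : V | b q) F q + \sum_(q : V | b q && (q j == a)) F q.
  rewrite [\sum_(q : V | b q) F q](bigID (fun q : V => q j == a)) /=.
  by rewrite addrAC addrr_F2 add0r.
by rewrite !split_at addrACA addrr_F2 add0r addrC.
Qed.

(** Stokes: the product is the coboundary of g_i dg_(s_1) u ... u dg_(s_k), so
    only the boundary of the face contributes. On a facet transverse to a
    direction [j != i] the function [g_j] is constant and dg_j kills the
    product; on [x_i = 0] the factor [g_i] vanishes; on the facet where [x_i] is
    maximal it is 1, and the sum is that of the induction hypothesis. *)
Lemma face_cup_sum (G : I -> V -> 'F_2) (s : seq I) :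
  (forall i q, q i = 0 -> G i q = 0) ->
  (forall i q, q i = ord_max -> G i q = 1) -> uniq s ->
  \sum_(q : V | face [set i in s] q) cup_diff unit_step (map G s) [set i in s] q = 1.
Proof.
move=> G0 G1; elim: s => [_|i s IH]; last rewrite cons_uniq => /andP[iNs us].
  rewrite /= (big_pred1 [ffun=> ord_max]) // => q.
  apply/forallP/eqP => [h|-> k]; last by rewrite !inE ffunE eqxx.
  apply/ffunP => k; rewrite ffunE; have := h k.
  by rewrite !inE eq_sym eqbF_neg negbK => /eqP.
set J := [set k in i :: s].
have sJ : #|J| = (size (map G s)).+1.
  by rewrite size_map /J cardsE; apply: (card_uniqP _); rewrite /= iNs.
have iJ : i \in J by rewrite !inE eqxx.
have JDi : J :\ i = [set k in s].
  by apply/setP => k; rewrite !inE; case: eqVneq => //= ->; rewrite (negPf iNs).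
rewrite map_cons; under eq_bigr do rewrite cup_exact //.
rewrite exchange_big /= (bigD1 i) //= [X in _ + X]big1 ?addr0; last first.
  move=> j /andP[jJ ji].
  have js : j \in s by move: jJ; rewrite !inE (negPf ji).
  have [s1 [s2 Es]] : exists s1 s2, s = s1 ++ j :: s2.
    by case/splitPr: js => s1 s2; exists s1, s2.
  have c0 a q : (a == 0) || (a == ord_max) -> q j = a ->
      cup_diff unit_step (map G s) (J :\ j) q = 0.
    move=> a0 qa.
    apply: (cup_eq0 (P := fun J' x => j \notin J' /\ x j = a) (g := G j)).
    - move=> J' k x kJ' [jJ' xa]; split; first by rewrite !inE negb_and jJ' orbT.
      rewrite !ffunE; case: eqP => [jk|_]; last by rewrite addr0.
      by rewrite jk kJ' in jJ'.
    - move=> _ _ x y [_ xa] [_ ya].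
      case/orP: a0 => /eqP a0; first by rewrite !G0 ?ya ?xa.
      by rewrite !G1 ?ya ?xa.
    - by rewrite Es; exists (map G s1), (map G s2); rewrite map_cat.
    - by rewrite !inE eqxx.
  rewrite (face_telescope (fun q => G i q * cup_diff unit_step (map G s) (J :\ j) q)) //.
  rewrite !big1 ?addr0 // => q.
    by case/andP => _ /eqP q0; rewrite (c0 0) ?mulr0.
  move=> /forallP/(_ j); rewrite !inE eqxx /= eq_sym eqbF_neg negbK => /eqP qm.
  by rewrite (c0 ord_max) ?mulr0 // eqxx orbT.
rewrite (face_telescope (fun q => G i q * cup_diff unit_step (map G s) (J :\ i) q)) //.
rewrite [X in _ + X]big1 ?addr0; last first.
  by move=> q /andP[_ /eqP q0]; rewrite G0 ?mul0r.
rewrite -[RHS]IH // JDi; apply: eq_bigr => q.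
move=> /forallP/(_ i); rewrite !inE (negPf iNs) eq_sym eqbF_neg negbK => /eqP qm.
by rewrite G1 ?mul1r.
Qed.

(** The product of the coboundaries of all the labellings is nonzero on some
    unit cube, hence along some edge path of this cube, on which every
    labelling must change. *)
Lemma cubical_sperner (lab : I -> V -> bool) :
  (forall i q, q i = 0 -> lab i q = false) ->
  (forall i q, q i = ord_max -> lab i q = true) ->
  exists q : V, forall i, exists x y : V,
    [/\ lab i x, ~~ lab i y,
        forall k, (q k <= x k <= (q k).+1)%N & forall k, (q k <= y k <= (q k).+1)%N].
Proof.
move=> lab0 lab1; pose G i q : 'F_2 := (lab i q)%:R.
have G0 i q : q i = 0 -> G i q = 0 by move=> /lab0; rewrite /G => ->.
have G1 i q : q i = ord_max -> G i q = 1 by move=> /lab1; rewrite /G => ->.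
have := face_cup_sum G0 G1 (enum_uniq I).
set J := [set i in enum I].
have iJ i : i \in J by rewrite inE mem_enum.
have [q /andP[fq /eqP cq] _|none] := pickP (fun q =>
    face J q && (cup_diff unit_step (map G (enum I)) J q != 0)); last first.
  rewrite big1; first by move/eqP; rewrite eq_sym oner_eq0.
  by move=> q fq; have := none q; rewrite /= fq /= => /negbFE/eqP.
exists q => i.
have qmax k : ((q k).+1 < M.+2)%N.
  have /forallP/(_ k) := fq; rewrite iJ eq_sym eqb_id => qk.
  by rewrite ltn_neqAle ltn_ord andbT.
have step k : nat_of_ord (q k + 1) = (q k).+1.
  by rewrite /= (modn_small (_ : 1 < M.+2)%N) // modn_small addn1.
pose P (J' : {set I}) (x : V) := forall k, x k = q k \/ (k \notin J' /\ x k = q k + 1).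
have Pnear J' x : P J' x -> forall k, (q k <= x k <= (q k).+1)%N.
  by move=> Px k; case: (Px k) => [->|[_ ->]]; rewrite ?step leqnn leqnSn.
have Pstep J' k x : k \in J' -> P J' x -> P (J' :\ k) (x + unit_step k).
  move=> kJ' Px l; rewrite !ffunE; case: eqP => [->|lk].
    right; split; first by rewrite !inE eqxx.
    by case: (Px k) => [->|] //; rewrite kJ' => -[].
  rewrite addr0; case: (Px l) => [->|[lJ' ->]]; [by left|right].
  by rewrite !inE negb_and lJ' orbT.
apply: contrapT => noxy; apply: cq.
apply: (cup_eq0 (P := P) (g := G i) Pstep).
- have near_eq J1 J2 x y : P J1 x -> P J2 y -> lab i x -> lab i y.
    move=> /Pnear Px /Pnear Py lx; apply: contrapT => /negP ly.
    by apply: noxy; exists x, y.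
  move=> J1 J2 x y Px Py; rewrite /G; congr ((_ : bool)%:R).
  by apply/idP/idP; [apply: near_eq Px Py|apply: near_eq Py Px].
- have: i \in enum I by rewrite mem_enum.
  case/splitPr => s1 s2.
  by exists (map G s1), (map G s2); rewrite map_cat.
- by move=> k; left.
Qed.
End Grid.

Local Open Scope classical_set_scope.

(** * Uniformity on compact sets *)
Section EpsDelta.
Context {R : realType} {V W : normedModType R}.
Implicit Types (A : set V) (f : V -> W).

Lemma within_continuousP A f : {within A, continuous f} <->
  forall x, A x -> forall e, 0 < e ->
    exists2 d, 0 < d & forall y, A y -> `|x - y| < d -> `|f x - f y| < e.
Proof.
rewrite subspace_continuousP; split=> h x Ax.
  move=> e e0; have /cvgrPdist_lt/(_ e e0) := h x Ax.
  rewrite near_withinE => /nbhs_normP[d /= d0 dP].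
  by exists d => // y Ay xy; apply: dP.
apply/cvgrPdist_lt => e e0; have [d d0 dP] := h x Ax e e0.
rewrite near_withinE; apply/nbhs_normP; exists d => // y /= xy Ay.
exact: dP.
Qed.

(** A property [P d x] holding for all small [d] locally uniformly in [x] holds
    on a compact set with a common [d]. *)
Lemma compact_uniform A (P : R -> V -> Prop) : compact A ->
  (forall x, A x -> exists2 r, 0 < r &
     forall x' d, A x' -> `|x - x'| < r -> 0 < d < r -> P d x') ->
  exists2 d, 0 < d & forall x, A x -> P d x.
Proof.
move=> /compact_near_coveringP/near_covering_withinP Ac loc.
have : \forall d \near (0 : R)^'+, A `<=` P d.
  apply: Ac => x Ax; have [r r0 rP] := loc x Ax.
  exists (ball x r, [set d | 0 < d < r]) => /=.
    split; first by apply/nbhs_ballP; exists r.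
    near=> d; apply/andP; split; near: d; last exact: nbhs_right_lt.
    exact: nbhs_right_gt.
  move=> [x' d] /= [xx' d0r] Ax'; apply: rP => //.
  by move: xx'; rewrite -ball_normE.
move=> /nbhs_ballP[r /= r0 rP].
exists (r / 2); first by rewrite divr_gt0.
apply: rP; last by rewrite divr_gt0.
rewrite -ball_normE /= sub0r normrN gtr0_norm; lra.
Unshelve. all: by end_near. Qed.

Lemma compact_uniform_continuous A f : compact A -> {within A, continuous f} ->
  forall e, 0 < e -> exists2 d, 0 < d &
    forall x y, A x -> A y -> `|x - y| < d -> `|f x - f y| < e.
Proof.
move=> Ac /within_continuousP fc e e0.
have [x Ax|d d0 dP] := @compact_uniform A
  (fun d x => forall y, A y -> `|x - y| < d -> `|f x - f y| < e) Ac; last first.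
  by exists d => // x y Ax Ay; exact: dP.
have [r r0 rP] := fc x Ax (e / 2) (divr_gt0 e0 (ltr0Sn _ 1)).
exists (r / 2) => [|x' d Ax' xx' /andP[d0 dr] y Ay x'y]; first by rewrite divr_gt0.
have fxx' : `|f x - f x'| < e / 2 by apply: rP => //; lra.
have fxy : `|f x - f y| < e / 2.
  by apply: rP => //; have := ler_distD x' x y; lra.
by have := ler_distD (f x) (f x') (f y); rewrite (distrC (f x') (f x)); lra.
Qed.

Lemma compact_bounded_away A f : compact A -> {within A, continuous f} ->
  (forall x, A x -> f x != 0) ->
  exists2 d, 0 < d & forall x, A x -> d <= `|f x|.
Proof.
move=> Ac /within_continuousP fc f0; apply: compact_uniform => // x Ax.
have fx0 : 0 < `|f x| / 2 by rewrite divr_gt0 // normr_gt0 f0.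
have [r r0 rP] := fc x Ax _ fx0.
exists (Num.min r (`|f x| / 2)); first by rewrite lt_min r0.
move=> x' d Ax'; rewrite !lt_min => /andP[/(rP _ Ax') xx' _] /and3P[_ _ dx].
by have := ler_distD (f x') (f x) 0; rewrite !subr0; lra.
Qed.
End EpsDelta.

Lemma continuous_dist {R : realType} {V : normedModType R} (c : V) :
  continuous (fun x => `|x - c|).
Proof. by move=> x; apply: (cvg_norm (cvgB cvg_id (cvg_cst c))). Qed.

Section RowNorm.
Context {R : realType} {n : nat}.
Implicit Types (v : 'rV[R]_n).

Lemma row_norm_leP v e : 0 <= e -> reflect (forall i, `|v 0 i| <= e) (`|v| <= e).
Proof.
move=> e0; rewrite [`|v|]mx_normrE; apply: (iffP idP) => [h i|h].
  apply: le_trans h; apply/bigmax_geP; right => /=.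
  by exists (0, i).
by apply/bigmax_leP; split=> // -[i j] _ /=; rewrite (ord1 i).
Qed.

Lemma row_coord_le v i : `|v 0 i| <= `|v|.
Proof. by move: i; apply/row_norm_leP. Qed.

Lemma row_norm_ltP v e : 0 < e -> reflect (forall i, `|v 0 i| < e) (`|v| < e).
Proof.
move=> e0; rewrite [`|v|]mx_normrE; apply: (iffP idP) => [h i|h].
  apply: le_lt_trans h; apply/bigmax_geP; right => /=.
  by exists (0, i).
by apply/bigmax_ltP; split=> // -[i j] _ /=; rewrite (ord1 i).
Qed.

Lemma closed_ball_row_compact (c : 'rV[R]_n) (r : R) :
  compact [set x | `|x - c| <= r].
Proof.
apply: bounded_closed_compact.
  exists (`|c| + r); split; first exact: num_real.
  move=> M rM x /= xr; have := ler_distD c x 0; rewrite !subr0; lra.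
have -> : [set x | `|x - c| <= r] = (fun x => `|x - c|) @^-1` [set y | y <= r] by [].
apply: closed_comp; last exact: closed_le.
by move=> x _; exact: continuous_dist.
Qed.

End RowNorm.

(** * Zeros of maps close to the identity *)
(** The i-th coordinate of [H] is nonnegative on the face x_i = 1 of the cube
    and nonpositive on the face x_i = -1. Labelling a fine grid by the signs of
    the coordinates gives a small cube where all the coordinates of [H] change
    sign, so that [H] is small there; if [H] had no zero, it would be bounded
    away from 0 by compactness. *)
Lemma near_identity_zero {R : realType} {n : nat} (H : 'rV[R]_n -> 'rV[R]_n) :
  {within [set x | `|x| <= 1], continuous H} ->
  (forall x, `|x| <= 1 -> `|x - H x| <= 1) ->
  exists2 x, `|x| <= 1 & H x = 0.
Proof.
set B := [set x | _] => Hc Hid; apply: contrapT => no_zero.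
have Bc : compact B.
  by have := @closed_ball_row_compact R n 0 1; under eq_set do rewrite subr0.
have [x Bx|d d0 dH] := compact_bounded_away Bc Hc.
  by apply/eqP => Hx0; apply: no_zero; exists x.
have [r r0 rH] := compact_uniform_continuous Bc Hc (divr_gt0 d0 (ltr0Sn _ 1)).
pose M := Num.truncn (2 / r); pose N : R := M.+1%:R.
have N0 : 0 < N by rewrite ltr0Sn.
have mesh : 2 / N < r.
  by rewrite ltr_pdivrMr // mulrC -ltr_pdivrMr // truncnS_gt.
pose pt (q : {ffun 'I_n -> 'I_M.+2}) : 'rV[R]_n := \row_i ((q i)%:R * (2 / N) - 1).
have N2N : N * (2 / N) = 2 by rewrite mulrCA divff ?mulr1 ?gt_eqF.
have N2 : 0 < 2 / N by rewrite divr_gt0.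
have ptB q : B (pt q).
  apply/row_norm_leP => // i; rewrite mxE ler_norml.
  have : (q i)%:R * (2 / N) <= N * (2 / N).
    by rewrite ler_pM2r // ler_nat -ltnS.
  have : 0 <= (q i)%:R * (2 / N) by rewrite mulr_ge0 // ltW.
  by rewrite N2N; set t := (q i)%:R * _ => t0 t2; apply/andP; split; lra.
(* The value on the faces is forced, since [H] may vanish on them. *)
pose lab i (q : {ffun 'I_n -> 'I_M.+2}) :=
  (q i == ord_max) || (q i != 0) && (0 < H (pt q) 0 i).
have lab_pos i q : lab i q -> 0 <= H (pt q) 0 i.
  move=> /orP[/eqP qi|/andP[_ /ltW //]].
  have := row_coord_le (pt q - H (pt q)) i; have := Hid _ (ptB q).
  rewrite !mxE qi /= -/N N2N => h1 h2.
  have := le_trans h2 h1; rewrite ler_norml => /andP[]; lra.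
have lab_neg i q : ~~ lab i q -> H (pt q) 0 i <= 0.
  rewrite negb_or negb_and negbK -leNgt => /andP[_ /orP[/eqP qi|//]].
  have := row_coord_le (pt q - H (pt q)) i; have := Hid _ (ptB q).
  rewrite !mxE qi /= mul0r => h1 h2.
  have := le_trans h2 h1; rewrite ler_norml => /andP[]; lra.
have [i q qi|i q qi|q qP] := @cubical_sperner _ _ lab.
- by rewrite /lab qi eqxx.
- by rewrite /lab qi eqxx.
have near (q' : {ffun 'I_n -> 'I_M.+2}) : (forall k, (q k <= q' k <= (q k).+1)%N) ->
    `|H (pt q) - H (pt q')| < d / 2.
  move=> qq'; apply: rH => //; apply: le_lt_trans mesh.
  apply/row_norm_leP => [|k]; first exact: ltW.
  have -> : (pt q - pt q') 0 k = ((q k)%:R - (q' k)%:R) * (2 / N).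
    by rewrite !mxE; ring.
  rewrite normrM (gtr0_norm N2).
  apply: ler_piMl; first exact: ltW.
  have /andP[q1 q2] := qq' k.
  by rewrite distrC -natrB // normr_nat (ler_nat R _ 1) leq_subLR addn1.
have : `|H (pt q)| <= d / 2.
  apply/row_norm_leP => [|i]; first by rewrite divr_ge0 // ltW.
  have [x [y [/lab_pos Hx /lab_neg Hy /near qx /near qy]]] := qP i.
  have := le_lt_trans (row_coord_le _ i) qx.
  have := le_lt_trans (row_coord_le _ i) qy.
  rewrite !mxE !ltr_norml => /andP[? ?] /andP[? ?].
  by rewrite ler_norml; apply/andP; split; lra.
by have := dH _ (ptB q); lra.
Qed.

(** * Lipschitz maps: images of spheres and uniform approximation *)
Lemma same_truncn_dist {R : realType} (x y : R) : 0 <= x -> 0 <= y ->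
  Num.truncn x = Num.truncn y -> `|x - y| <= 1.
Proof.
move=> x0 y0 xy; have /andP[x1 x2] := truncn_itv x0.
have /andP[] := truncn_itv y0; rewrite -xy => y1 y2.
move: x2 y2; rewrite -natr1 => x2 y2.
by rewrite ler_norml; apply/andP; split; lra.
Qed.

(** The exponents differ by one: cells are counted on a sphere, targets in the
    whole space. *)
Lemma cells_lt_targets (n A M : nat) :
  (0 < A)%N -> M = (2 * n.+1 * (2 * A) ^ n).+1 ->
  (n.+1 * 2 * (A * M).+1 ^ n < M ^ n.+1)%N.
Proof.
move=> A0 ME; have M0 : (0 < M)%N by rewrite ME.
have h : ((A * M).+1 ^ n <= (2 * A) ^ n * M ^ n)%N.
  have AM : ((A * M).+1 <= 2 * A * M)%N.
    by rewrite -mulnA mul2n -addnn -addn1 leq_add2l muln_gt0 A0.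
  by rewrite -expnMn; case: (n) => // k; rewrite leq_exp2r.
apply: (leq_ltn_trans (leq_mul (leqnn _) h)).
by rewrite expnS mulnA ltn_pmul2r ?expn_gt0 ?M0 // ME (mulnC n.+1).
Qed.

(** If the image covered a ball, it would contain the M^n points of a grid of
    mesh rho / M. Cut the faces of the sphere (a cube, for the sup norm) into
    cells so small that the image of a cell contains at most one of these
    points; this takes O(M^(n-1)) cells, which is less than M^n for M large. *)
Lemma sphere_image_misses {R : realType} {n : nat} (g : 'rV[R]_n -> 'rV[R]_n)
    (c : 'rV[R]_n) (eps L rho : R) : 0 < eps -> 0 <= L -> 0 < rho ->
  (forall x y, `|x - c| = eps -> `|y - c| = eps -> `|g x - g y| <= L * `|x - y|) ->
  exists2 v, `|v| < rho & forall y, `|y - c| = eps -> g y != v.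
Proof.
move=> eps0 L0 rho0 gL; case: n => [|n] in g c gL *.
  exists 0; first by rewrite normr0.
  by move=> y; rewrite [y - c]thinmx0 normr0 => eE; rewrite -eE ltxx in eps0.
apply: contrapT => no_v.
pose A := (Num.truncn (2 * eps * L / rho)).+1.
pose M := (2 * n.+1 * (2 * A) ^ n).+1; pose K := (A * M)%N.
have K0 : 0 < K%:R :> R by rewrite ltr0n muln_gt0.
have M0 : 0 < M%:R :> R by rewrite ltr0n.
have mesh0 : 0 <= 2 * eps / K%:R by apply: divr_ge0; [lra|exact: ltW].
have fine_mesh : L * (2 * eps / K%:R) < rho / M%:R.
  rewrite natrM invfM !mulrA ltr_pM2r ?invr_gt0 // ltr_pdivrMr ?ltr0n //.
  have : 2 * eps * L / rho < A%:R by exact: truncnS_gt.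
  rewrite ltr_pdivrMr //.
  by have -> : L * 2 * eps = 2 * eps * L; [ring|rewrite (mulrC rho)].
pose target (a : {ffun 'I_n.+1 -> 'I_M}) : 'rV[R]_n.+1 :=
  \row_i ((a i)%:R * (rho / M%:R)).
have s0 : 0 < rho / M%:R by rewrite divr_gt0.
have target_lt a : `|target a| < rho.
  apply/row_norm_ltP => // i; rewrite mxE normrM normr_nat (gtr0_norm s0).
  by rewrite mulrCA gtr_pMr // ltr_pdivrMr // mul1r ltr_nat.
have /choice[S SP] : forall a, exists y, `|y - c| = eps /\ g y = target a.
  move=> a; apply: contrapT => no_y; apply: no_v.
  exists (target a) => // y yc; apply/eqP => gy.
  by apply: no_y; exists y.
(* The face of the cube containing [S a]: a coordinate and a sign. *)
have /choice[F FP] : forall a, exists jb : 'I_n.+1 * bool,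
    (S a - c) 0 jb.1 = (-1) ^+ jb.2 * eps.
  move=> a; have [Sa _] := SP a.
  have /mx_norm_neq0[[i j] /=] : mx_norm (S a - c) != 0.
    by rewrite -[mx_norm _]/(`|S a - c|) Sa gt_eqF.
  rewrite -[mx_norm _]/(`|S a - c|) Sa (ord1 i) => ->.
  exists (j, (S a - c) 0 j < 0); rewrite /=.
  case: (ltP ((S a - c) 0 j) 0) => h.
    by rewrite (ltr0_norm h) expr1 mulN1r opprK.
  by rewrite (ger0_norm h) expr0 mul1r.
(* The coordinates on the cube, rescaled to [0, K]; [code] records the face and
   the integral parts of the coordinates along it. *)
pose u a i : R := ((S a - c) 0 i + eps) / (2 * eps) * K%:R.
have u_itv a i : 0 <= u a i <= K%:R.
  have := row_coord_le (S a - c) i; rewrite (proj1 (SP a)) ler_norml => /andP[lo hi].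
  apply/andP; split.
    by apply: mulr_ge0; [apply: divr_ge0; lra|exact: ltW].
  apply: ler_piMl; first exact: ltW.
  by rewrite ler_pdivrMr; lra.
pose cell a k := inord (Num.truncn (u a (lift (F a).1 k))) : 'I_K.+1.
pose code a := (F a, [ffun k : 'I_n => cell a k]).
have code_inj : injective code.
  move=> a b [Fab cellab].
  have cell_eq k : Num.truncn (u a (lift (F a).1 k)) = Num.truncn (u b (lift (F a).1 k)).
    have := congr1 (fun f : {ffun 'I_n -> 'I_K.+1} => nat_of_ord (f k)) cellab.
    have lt_K x j : (Num.truncn (u x j) < K.+1)%N.
      have /andP[ulo uhi] := u_itv x j.
      by rewrite ltnS -(ler_nat R) (le_trans _ uhi) // truncn_le.
    by rewrite !ffunE /cell -Fab !inordK.
  have dS : `|S a - S b| <= 2 * eps / K%:R.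
    apply/row_norm_leP => [//|i].
    have -> : (S a - S b) 0 i = (S a - c) 0 i - (S b - c) 0 i.
      by rewrite !mxE; ring.
    case: (unliftP (F a).1 i) => [k|] ->; last first.
      by rewrite FP Fab FP subrr normr0.
    set i' := lift _ k.
    have /andP[ua _] := u_itv a i'; have /andP[ub _] := u_itv b i'.
    have := same_truncn_dist ua ub (cell_eq k).
    have -> : u a i' - u b i' = ((S a - c) 0 i' - (S b - c) 0 i') * (K%:R / (2 * eps)).
      by rewrite /u; field; rewrite gt_eqF.
    have q0 : 0 < K%:R / (2 * eps) by rewrite divr_gt0 // mulr_gt0.
    by rewrite normrM (gtr0_norm q0) -ler_pdivlMr // mul1r invf_div.
  apply/ffunP => i; apply: val_inj => /=; apply/eqP.
  have := gL _ _ (proj1 (SP a)) (proj1 (SP b)).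
  rewrite (proj2 (SP a)) (proj2 (SP b)) => gab.
  have /(row_norm_ltP _ s0)/(_ i) : `|target a - target b| < rho / M%:R.
    apply: le_lt_trans gab _; apply: le_lt_trans fine_mesh.
    by rewrite ler_wpM2l.
  rewrite !mxE -mulrBl normrM (gtr0_norm s0) gtr_pMl //.
  wlog le_ba : a b {Fab cellab cell_eq dS gab} / (b i <= a i)%N => [W|].
    case/orP: (leq_total (b i) (a i)) => [/W //|/W h].
    by rewrite distrC eq_sym; apply: h.
  rewrite -natrB // normr_nat (ltr_nat R _ 1) ltnS leqn0 subn_eq0 => le_ab.
  by rewrite eqn_leq le_ab.
have := leq_card _ code_inj.
rewrite card_ffun !card_prod card_ffun !card_ord card_bool.
by rewrite leqNgt (cells_lt_targets _ (erefl M)).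
Qed.

(** The infimal convolution of [f] with the cone L |.| is L-Lipschitz and lies
    below [f] on [A]. It is close to [f] once L is large: points at distance at
    least [r] are then too costly to enter the infimum, and [f] varies by less
    than [delta] on smaller distances. *)
Lemma lipschitz_approx {R : realType} {n m : nat} (A : set 'rV[R]_n)
    (f : 'rV[R]_n -> 'rV[R]_m) (delta : R) :
  compact A -> A !=set0 -> {within A, continuous f} -> 0 < delta ->
  exists (L : R) (g : 'rV[R]_n -> 'rV[R]_m),
    [/\ 0 <= L, forall x y, `|g x - g y| <= L * `|x - y| &
        forall x, A x -> `|f x - g x| <= delta].
Proof.
move=> Ac [z0 Az0] fc delta0.
have [r r0 rf] := compact_uniform_continuous Ac fc delta0.
have [M M0 fM] : exists2 M, 0 <= M & forall x, A x -> `|f x| <= M.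
  have [B [_ fB]] := compact_bounded (continuous_compact fc Ac).
  exists (`|B| + 1); first by rewrite addr_ge0.
  move=> x Ax; apply: (fB (`|B| + 1)); last by exists x.
  by rewrite (le_lt_trans (ler_norm B)) // ltrDl.
have fM_coord z i : A z -> - M <= f z 0 i <= M.
  by move=> Az; rewrite -ler_norml (le_trans (row_coord_le _ i)) ?fM.
pose L := 2 * M / r.
have L0 : 0 <= L by rewrite divr_ge0 ?mulr_ge0 // ltW.
pose S y i := [set f z 0 i + L * `|y - z| | z in A].
have S_nonempty y i : S y i !=set0 by exists (f z0 0 i + L * `|y - z0|), z0.
have S_lb y i : has_lbound (S y i).
  exists (- M) => _ [z Az <-]; have /andP[fz _] := fM_coord z i Az.
  by have := mulr_ge0 L0 (normr_ge0 (y - z)); lra.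
pose g y : 'rV[R]_m := \row_i inf (S y i).
have g_le x y i : g x 0 i - g y 0 i <= L * `|x - y|.
  rewrite lerBlDr -lerBlDl !mxE; apply: lb_le_inf => // _ [z Az <-].
  have /ge_inf : S x i (f z 0 i + L * `|x - z|) by exists z.
  move=> /(_ (S_lb x i)) h.
  by have := ler_wpM2l L0 (ler_distD y x z); rewrite mulrDr; lra.
exists L, g; split=> // [x y|x Ax].
  apply/row_norm_leP => [|i]; first by rewrite mulr_ge0.
  rewrite !mxE ler_norml; have := g_le x y i; have := g_le y x i.
  by rewrite (distrC y) !mxE => h1 h2; apply/andP; split; lra.
apply/row_norm_leP => [|i]; first exact: ltW.
have gx_le : g x 0 i <= f x 0 i.
  rewrite mxE; apply: ge_inf => //; exists x => //.
  by rewrite subrr normr0 mulr0 addr0.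
have gx_ge : f x 0 i - delta <= g x 0 i.
  rewrite [g x 0 i]mxE; apply: lb_le_inf => // _ [z Az <-].
  have Lxz := mulr_ge0 L0 (normr_ge0 (x - z)).
  case: (ltP `|x - z| r) => [/(rf _ _ Ax Az) fxz|rxz].
    have := le_lt_trans (row_coord_le _ i) fxz.
    by rewrite !mxE ltr_norml => /andP[]; lra.
  have /andP[_ fx] := fM_coord x i Ax; have /andP[fz _] := fM_coord z i Az.
  have : L * r <= L * `|x - z| by rewrite ler_wpM2l.
  by rewrite /L mulfVK ?gt_eqF //; lra.
by move: gx_le gx_ge; rewrite !mxE => h1 h2; rewrite ger0_norm; lra.
Qed.

(** * Inverses and extensions of continuous maps *)
Lemma within_continuous_comp {R : realType} {U V W : normedModType R}
    (A : set U) (B : set V) (f : U -> V) (g : V -> W) :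
  (forall x, A x -> B (f x)) ->
  {within A, continuous f} -> {within B, continuous g} ->
  {within A, continuous (g \o f)}.
Proof.
move=> AB /within_continuousP fc /within_continuousP gc.
apply/within_continuousP => x Ax e e0.
have [d d0 gd] := gc _ (AB _ Ax) e e0; have [r r0 fr] := fc _ Ax d d0.
by exists r => // y Ay xy; apply: gd; [exact: AB|exact: fr].
Qed.

Lemma within_continuousB {R : realType} {V W : normedModType R} (A : set V)
    (f : V -> W) (a : W) :
  {within A, continuous f} -> {within A, continuous (fun x => f x - a)}.
Proof.
move=> /within_continuousP fc; apply/within_continuousP => x Ax e e0.
have [d d0 fd] := fc x Ax e e0.
by exists d => // y Ay /(fd y Ay); rewrite opprB addrA subrK.
Qed.

Lemma lipschitz_within_continuous {R : realType} {V W : normedModType R}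
    (A : set V) (f : V -> W) (L : R) : 0 <= L ->
  (forall x y, `|f x - f y| <= L * `|x - y|) -> {within A, continuous f}.
Proof.
move=> L0 fL; apply/within_continuousP => x _ e e0.
have L1 : 0 < L + 1 by lra.
exists (e / (L + 1)) => [|y _]; first by rewrite divr_gt0.
rewrite ltr_pdivlMr // mulrC mulrDl mul1r => h.
have := fL x y; have := normr_ge0 (x - y); lra.
Qed.

Section CompactInverse.
Context {R : realType} {V W : normedModType R}.
Variables (A : set V) (f : V -> W) (g : W -> V).
Hypotheses (Ac : compact A) (fc : {within A, continuous f}).
Hypothesis gK : forall x, A x -> g (f x) = x.

(** Away from a neighbourhood of [x], the function |f - f x| is bounded below
    on the compact set [A], by injectivity. *)
Lemma compact_inverse_continuous : {within f @` A, continuous g}.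
Proof.
apply/within_continuousP => _ [x Ax <-] e e0.
pose A' := A `&` [set x' | e <= `|x' - x|].
have A'c : compact A'.
  apply: compact_closedI => //.
  have -> : [set x' | e <= `|x' - x|] =
      (fun x' : V => `|x' - x|) @^-1` [set y | e <= y] by [].
  apply: closed_comp; last exact: closed_ge.
  by move=> x' _; exact: continuous_dist.
have f'c : {within A', continuous (fun x' => f x' - f x)}.
  apply: within_continuousB.
  by apply: continuous_subspaceW fc => y [].
have [x' [Ax' x'x]|d d0 dA'] := compact_bounded_away A'c f'c.
  rewrite subr_eq0; apply/eqP => fxx'.
  move: x'x; rewrite /= -(gK Ax') fxx' gK // subrr normr0; lra.
exists d => // _ [y Ay <-] fxy; rewrite !gK //.
rewrite ltNge distrC; apply/negP => xy.
by have := dA' y (conj Ay xy); rewrite distrC; lra.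
Qed.

End CompactInverse.

Lemma row_extension {R : realType} {n m : nat} (A : set 'rV[R]_n)
    (f : 'rV[R]_n -> 'rV[R]_m) :
  closed A -> {within A, continuous f} -> (forall x, A x -> `|f x| <= 1) ->
  exists2 g : 'rV[R]_n -> 'rV[R]_m, continuous g & forall x, A x -> g x = f x.
Proof.
move=> Acl fc f1.
have ext i : exists g : 'rV[R]_n -> R, continuous g /\ forall x, A x -> g x = f x 0 i.
  have fic : {within A, continuous (fun x => f x 0 i : R^o)}.
    apply/within_continuousP => x Ax e e0.
    have [d d0 fd] := proj1 (within_continuousP _ _) fc x Ax e e0.
    exists d => // y Ay /(fd y Ay) fxy; apply: le_lt_trans fxy.
    by have := row_coord_le (f x - f y) i; rewrite !mxE.
  have fi1 x : A x -> `|f x 0 i : R^o| <= 1.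
    by move=> /f1; apply: le_trans; exact: row_coord_le.
  have [g [fg gc _]] := continuous_bounded_extension pseudometric_normal Acl ltr01 fic fi1.
  exists g; split=> // x Ax.
  by rewrite -fg ?inE.
have [g gP] := choice ext.
exists (fun x => \row_i g i x) => [x|x Ax]; last first.
  by apply/rowP => i; rewrite mxE (proj2 (gP i)).
apply/(@cvgrPdist_lt _ _ _ _ (nbhs_filter x)) => e e0.
have near_all : \forall y \near nbhs x, forall i, `|g i x - g i y| < e.
  apply: (@filter_forall _ _ (fun i y => `|g i x - g i y| < e) (nbhs x)) => i.
  by have /cvgrPdist_lt/(_ e e0) := proj1 (gP i) x.
near=> y; apply/row_norm_ltP => // i; rewrite !mxE; move: i.
by near: y.
Unshelve. all: by end_near. Qed.

(** * Invariance of domain *)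
Section PushOut.
Context {R : realType} {V : normedModType R}.
Variables (c : V) (eps : R).
Hypothesis eps0 : 0 < eps.

(** The identity outside the ball of radius [eps], and the radial projection
    onto its boundary inside it. *)
Definition push_out (y : V) : V := c + Num.max 1 (eps / `|y - c|) *: (y - c).

Lemma push_out_id y : eps <= `|y - c| -> push_out y = y.
Proof.
move=> yc; have yc0 : 0 < `|y - c| by apply: lt_le_trans yc.
rewrite /push_out max_l ?scale1r ?[c + _]addrC ?subrK //.
by rewrite ler_pdivrMr // mul1r.
Qed.

Lemma push_out_sphere y : y != c -> `|y - c| <= eps -> `|push_out y - c| = eps.
Proof.
move=> yc ye; have yc0 : 0 < `|y - c| by rewrite normr_gt0 subr_eq0.
rewrite /push_out addrAC subrr add0r max_r; last first.
  by rewrite ler_pdivlMr // mul1r.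
by rewrite normrZ gtr0_norm ?divr_gt0 // mulfVK // gt_eqF.
Qed.

Lemma push_out_continuous (A : set V) : ~ A c -> {within A, continuous push_out}.
Proof.
move=> cA; apply: continuous_in_subspaceT => y; rewrite inE => Ay.
have yc : `|y - c| != 0.
  by rewrite normr_eq0 subr_eq0; apply: contra_not_neq cA => <-.
apply: cvgD; first exact: cvg_cst.
apply: cvgZ; last by apply: cvgB; [exact: cvg_id|exact: cvg_cst].
apply: (@continuous_max _ _ (fun=> 1) (fun y => eps / `|y - c|)).
  exact: cvg_cst.
apply: cvgM; first exact: cvg_cst.
apply: cvgV => //; exact: continuous_dist.
Qed.
End PushOut.

(** The core of invariance of domain; the strategy is explained at the top of
    the file, with [G] the extended inverse, [P] its Lipschitz approximation
    and [v] the small vector that [P] avoids on the sphere. *)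
Lemma unit_ball_image_nbhs {R : realType} {n : nat} (f : 'rV[R]_n -> 'rV[R]_n) :
  {within [set x | `|x| <= 1], continuous f} ->
  (forall x y, `|x| <= 1 -> `|y| <= 1 -> f x = f y -> x = y) ->
  exists2 e, 0 < e &
    forall y, `|y - f 0| < e -> exists2 x, `|x| <= 1 & f x = y.
Proof.
set B := [set x | _] => fc finj.
have Bc : compact B.
  by have := @closed_ball_row_compact R n 0 1; under eq_set do rewrite subr0.
have B0 : B 0 by rewrite /B /= normr0.
pose K := f @` B.
have Kc : compact K := continuous_compact fc Bc.
have Kcl : closed K by apply: compact_closed Kc; exact: norm_hausdorff.
have [g gP] : exists g : 'rV[R]_n -> 'rV[R]_n, forall x, B x -> g (f x) = x.
  have /choice[g gP] : forall y, exists x, K y -> B x /\ f x = y.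
    move=> y; have [[x Bx fx]|nKy] := pselect (K y); first by exists x.
    by exists 0.
  exists g => x Bx; have [Bg fg] := gP (f x) (ex_intro2 _ _ x Bx erefl).
  exact: finj.
have gc : {within K, continuous g} := compact_inverse_continuous Bc fc gP.
have [G Gc GK] : exists2 G : 'rV[R]_n -> 'rV[R]_n, continuous G & forall y, K y -> G y = g y.
  by apply: row_extension => // _ [x Bx <-]; rewrite gP.
have Gf x : B x -> G (f x) = x by move=> Bx; rewrite GK ?gP //; exists x.
have [eps eps0 Gsmall] : exists2 eps, 0 < eps &
    forall y, `|f 0 - y| < 2 * eps -> `|G y| < 10^-1.
  have tenth : 0 < 10^-1 :> R by rewrite invr_gt0.
  have GcT : {within setT, continuous G} by exact: continuous_subspaceT.
  have [d d0 dG] := proj1 (within_continuousP _ _) GcT (f 0) I _ tenth.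
  exists (d / 2) => [|y yd]; first by rewrite divr_gt0.
  have := dG y I; rewrite Gf // sub0r normrN; apply.
  by move: yd; rewrite mulrC divfK.
apply: contrapT => no_e.
have [c cf0 cK] : exists2 c, `|c - f 0| < eps & ~ K c.
  apply: contrapT => no_c; apply: no_e; exists eps => // y yf0.
  by apply: contrapT => Ky; apply: no_c; exists y => // -[x Bx fx]; apply: Ky; exists x.
pose K1 := K `&` [set y | eps <= `|y - c|].
have K1c : compact K1.
  apply: compact_closedI => //.
  have -> : [set y | eps <= `|y - c|] =
      (fun y : 'rV[R]_n => `|y - c|) @^-1` [set r | eps <= r] by [].
  apply: closed_comp; last exact: closed_ge.
  by move=> y _; exact: continuous_dist.
have [_ [[x Bx <-] /= xc]|d0 d00 GK1] :=
    compact_bounded_away K1c (continuous_subspaceT Gc).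
  rewrite Gf //; apply: contraTneq xc => ->.
  by rewrite -ltNge distrC.
pose C := K `|` [set y | `|y - c| <= eps].
have Cc : compact C by apply: compactU => //; exact: closed_ball_row_compact.
have C0 : C !=set0 by exists (f 0); left; exists 0.
pose d : R := Num.min (d0 / 4) 10^-1.
have d_gt0 : 0 < d by rewrite lt_min; apply/andP; split; lra.
have d_d0 : d <= d0 / 4 by rewrite ge_min lexx.
have d_10 : d <= 10^-1 by rewrite ge_min lexx orbT.
have [L [P [L0 PL PG]]] := lipschitz_approx Cc C0 (continuous_subspaceT Gc) d_gt0.
have [v vd Pv] := sphere_image_misses eps0 L0 d_gt0 (fun x y _ _ => PL x y) (c := c).
have Kneqc y : K y -> y != c by move=> Ky; apply: contra_not_neq cK => <-.
have Pc : {within setT, continuous P} := lipschitz_within_continuous L0 PL.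
have Hc : {within B, continuous (fun x => P (push_out c eps (f x)) - v)}.
  apply: within_continuousB.
  apply: (within_continuous_comp (B := K) (f := f)
    (g := P \o push_out c eps)) => // [x Bx|]; first by exists x.
  apply: (within_continuous_comp (B := setT)) => //.
  exact: push_out_continuous.
have PGle y : C y -> `|P y - G y| <= d by move=> /PG; rewrite distrC.
(* The perturbed map stays within distance 1 of the identity, as required by
   [near_identity_zero]: outside the ball it differs from [G] by at most 2 d,
   and inside both are small. The zero it must then have is impossible. *)
have [x Bx|x Bx /eqP] := near_identity_zero Hc.
  have Kfx : K (f x) by exists x.
  rewrite -{1}(Gf _ Bx).
  case: (lerP eps `|f x - c|) => fxc.
    rewrite push_out_id //.
    have := PG _ (or_introl Kfx : C (f x)).
    have := ler_normD (G (f x) - P (f x)) v.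
    have -> : G (f x) - P (f x) + v = G (f x) - (P (f x) - v) by rewrite opprB addrA addrAC.
    lra.
  have [z zE] : {z | push_out c eps (f x) = z} by eexists.
  have zc : `|z - c| = eps by rewrite -zE push_out_sphere ?Kneqc // ltW.
  have Cz : C z by right; rewrite /= zc.
  rewrite zE.
  have G1 : `|G (f x)| < 10^-1.
    apply: Gsmall; have := ler_distD c (f 0) (f x).
    by rewrite (distrC (f 0) c) (distrC c (f x)); lra.
  have G2 : `|G z| < 10^-1.
    apply: Gsmall; have := ler_distD c (f 0) z.
    by rewrite (distrC (f 0) c) (distrC c z); lra.
  have := PGle z Cz.
  have := ler_normB (G (f x)) (P z - v); have := ler_normB (P z) v.
  have := ler_normD (P z - G z) (G z); rewrite subrK.
  lra.
have Kfx : K (f x) by exists x.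
rewrite subr_eq0; case: (lerP eps `|f x - c|) => fxc.
  rewrite push_out_id // => /eqP Pfx.
  have := GK1 _ (conj Kfx fxc).
  have := PG _ (or_introl Kfx : C (f x)).
  have := ler_normD (G (f x) - P (f x)) (P (f x)); rewrite subrK Pfx.
  lra.
by apply/negP; apply: Pv; rewrite push_out_sphere ?Kneqc // ltW.
Qed.

Lemma invariance_of_domain {R : realType} {n : nat} (X : set 'rV[R]_n)
    (Phi : 'rV[R]_n -> 'rV[R]_n) (p : 'rV[R]_n) :
  open X -> {within X, continuous Phi} ->
  (forall x y, X x -> X y -> Phi x = Phi y -> x = y) -> X p ->
  exists r e : R, [/\ 0 < r, 0 < e, forall x, `|x - p| <= r -> X x &
    forall y, `|y - Phi p| < e -> exists2 x, `|x - p| <= r & Phi x = y].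
Proof.
move=> Xo Phic Phi_inj Xp.
have [r r0 rX] : exists2 r, 0 < r & forall x, `|x - p| <= r -> X x.
  have /nbhs_ballP[r /= r0 rX] : nbhs p X by exact: open_nbhs_nbhs.
  exists (r / 2) => [|x xr]; first by rewrite divr_gt0.
  by apply: rX; rewrite -ball_normE /= distrC; lra.
pose f x := Phi (p + r *: x).
have scaleX x : `|x| <= 1 -> X (p + r *: x).
  move=> x1; apply: rX; rewrite addrAC subrr add0r normrZ gtr0_norm //.
  by rewrite ler_piMr // ltW.
have [|x y x1 y1 /Phi_inj|e e0 eP] := @unit_ball_image_nbhs _ _ f.
- apply: (within_continuous_comp (B := X) (f := fun x => p + r *: x) (g := Phi)) => //.
  apply: (@lipschitz_within_continuous _ _ _ _ _ r) => [|x y]; first exact: ltW.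
  by rewrite opprD addrACA subrr add0r -scalerBr normrZ gtr0_norm.
- move=> /(_ (scaleX _ x1) (scaleX _ y1)) /addrI.
  by apply: scalerI; rewrite gt_eqF.
exists r, e; split=> // y yp.
have [|x x1 <-] := eP y; first by rewrite /f scaler0 addr0.
exists (p + r *: x) => //.
rewrite addrAC subrr add0r normrZ gtr0_norm //.
by rewrite ler_piMr // ltW.
Qed.

(** The chart is the local inverse of [Phi], translated to the origin and
    preceded by the exchange of the coordinate [i] with the last one. *)
Lemma injective_topologically_ordinary {R : realType} {n : nat}
    (X : set 'rV[R]_n) (Phi : 'rV[R]_n -> 'rV[R]_n) (i : 'I_n) (p : 'rV[R]_n) :
  open X -> {within X, continuous Phi} ->
  (forall x y, X x -> X y -> Phi x = Phi y -> x = y) -> X p ->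
  topologically_ordinary X (fun x => Phi x 0 i) p.
Proof.
move=> Xo Phic Phi_inj Xp; split=> //.
have [r [e [r0 e0 rX eP]]] := invariance_of_domain Xo Phic Phi_inj Xp.
have [last lastE] : exists last : 'I_n, last.+1 = n.
  by case: n i {X Phi p Xo Phic Phi_inj Xp r e r0 e0 rX eP} => [[]//|n _]; exists ord_max.
pose swap (v : 'rV[R]_n) := col_perm (tperm i last) v.
have swapK v : swap (swap v) = v by apply/rowP => k; rewrite !mxE tpermK.
have swapB u v : swap u - swap v = swap (u - v) by apply/rowP => k; rewrite !mxE.
have swap_norm v : `|swap v| <= `|v|.
  by apply/row_norm_leP => // k; rewrite mxE row_coord_le.
have swap_lip u v : `|swap u - swap v| <= 1 * `|u - v| by rewrite swapB mul1r.
pose B := [set x | `|x - p| <= r].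
have BX : B `<=` X by exact: rX.
have Bc : compact B by exact: closed_ball_row_compact.
have [g gK] : exists g : 'rV[R]_n -> 'rV[R]_n, forall x, B x -> g (Phi x) = x.
  have /choice[g gP] : forall y, exists x, (Phi @` B) y -> B x /\ Phi x = y.
    move=> y; have [[x Bx xy]|ny] := pselect ((Phi @` B) y); first by exists x.
    by exists 0.
  exists g => x Bx; have [Bg Phig] := gP (Phi x) (ex_intro2 _ _ x Bx erefl).
  by apply: Phi_inj => //; apply: BX.
have gc : {within Phi @` B, continuous g}.
  by apply: compact_inverse_continuous => //; exact: continuous_subspaceW Phic.
pose V := [set v : 'rV[R]_n | `|v| < e].
pose eta v := g (Phi p + swap v).
have V_image v : V v -> (Phi @` B) (Phi p + swap v).
  move=> Vv; have [|x Bx xv] := eP (Phi p + swap v); last by exists x.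
  by rewrite addrAC subrr add0r (le_lt_trans (swap_norm v)).
have etaB v : V v -> B (eta v) /\ Phi (eta v) = Phi p + swap v.
  by move=> /V_image[x Bx xv]; rewrite /eta -xv gK.
have etaX : eta @` V `<=` X by move=> _ [v /etaB[Bv _] <-]; exact: BX.
exists V, eta; split=> //.
- by apply/nbhs_ballP; exists e => // v; rewrite -ball_normE /= sub0r normrN.
- split.
    apply: (within_continuous_comp (f := fun v => Phi p + swap v) (g := g) V_image) => //.
    apply: (@lipschitz_within_continuous _ _ _ _ _ 1) => // u v.
    by rewrite opprD addrACA subrr add0r.
  exists (fun x => swap (Phi x - Phi p)); split.
    by move=> v /etaB[_ ->]; rewrite addrAC subrr add0r swapK.
  apply: (within_continuous_comp (B := setT) (f := fun x => Phi x - Phi p) (g := swap)) => //.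
    by apply: within_continuousB; exact: continuous_subspaceW Phic.
  exact: (lipschitz_within_continuous ler01 swap_lip).
- have Bp : B p by rewrite /B /= subrr normr0 ltW.
  have swap0 : swap 0 = 0 by apply/rowP => k; rewrite !mxE.
  by rewrite /eta swap0 addr0 gK.
- move=> v /etaB[_ ->] j jn; rewrite !mxE tpermL; congr (_ + v 0 _).
  by apply: val_inj; apply: succn_inj; rewrite lastE jn.
Qed.

(** Uniqueness is used backwards in time: two curves meeting at time T coincide
    at time 0. *)
Lemma node_endpoint_injective {R : realType} {n d : nat} (T : R)
    (f : 'rV[R]_(n + d) -> R -> 'rV[R]_(n + d)) (X : set 'rV[R]_n)
    (Phi : 'rV[R]_n -> 'rV[R]_n) :
  0 <= T -> assumption1 T f [set row_mx x 0 | x in X] -> assumption2 T f ->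
  (forall x, X x -> forall h, ivp_solution T f (row_mx x 0) h ->
     rsubmx (h T) = 0 /\ Phi x = lsubmx (h T)) ->
  forall x y, X x -> X y -> Phi x = Phi y -> x = y.
Proof.
move=> T0 [_ ex] [_ uniq] end_eq x y Xx Xy xy.
have [h1 h1s] := ex _ (ex_intro2 _ _ x Xx erefl).
have [h2 h2s] := ex _ (ex_intro2 _ _ y Xy erefl).
have [r1 l1] := end_eq x Xx h1 h1s; have [r2 l2] := end_eq y Xy h2 h2s.
have h12T : h1 T = h2 T by rewrite -[h1 T]hsubmxK -[h2 T]hsubmxK r1 r2 -l1 -l2 xy.
have [h10 h1o] := h1s; have [h20 h2o] := h2s.
pose J := [set t : R | 0 <= t <= T].
have Jitv : is_interval J.
  move=> a b /andP[a0 _] /andP[_ bT] c /andP[ac cb].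
  by rewrite /J /= (le_trans a0 ac) (le_trans cb bT).
have J0 : (J `&` J) 0 by split; rewrite /J /= lexx.
have JT : (J `&` J) T by split; rewrite /J /= lexx T0.
have := uniq J J h1 h2 Jitv (@subset_refl _ J) Jitv (@subset_refl _ J) h1o h2o
  (ex_intro2 _ _ T JT h12T) 0 J0.
by rewrite h10 h20 => /eq_row_mx[].
Qed.

Theorem theorem2p13 (R : realType) (T : R) (T_gt0 : 0 < T) (n : nat)
  (X : set 'rV[R]_n) (Xopen : open X)
  (Phi : 'rV[R]_n -> 'rV[R]_n) (Phi_cont : {within X, continuous Phi})
  (i : 'I_n)
  (PhiMorse : topological_Morse X (fun x => Phi x 0 i))
  (PhiCritical : exists p, topologically_critical X (fun x => Phi x 0 i) p) :
  ~ embeddable_in_NODE3 T X Phi.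
Proof.
case: PhiCritical => p [Xp not_ordinary] [d [f [_ ex uniq end_eq]]].
apply: not_ordinary; apply: injective_topologically_ordinary => //.
exact: node_endpoint_injective (ltW T_gt0) ex uniq end_eq.
Qed.
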